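(* Let $\Theta=\{\theta_1,\ldots,\theta_n\}$ with $n\ge 2$, let $k\ge 2$, and let $m_1,\ldots,m_k$ be basic belief assignments on $2^\Theta$ given by a mass matrix $\mathbf{M}$ with $k$ rows and $n+1$ columns, corresponding to $\theta_1,\ldots,\theta_n$ and to one uncertainty $\theta_{i_1}\cup\cdots\cup\theta_{i_s}$ different from the total uncertainty $\theta_1\cup\theta_2\cup\cdots\cup\theta_n$ (all other masses being zero). Suppose that: (i) each column contains at least one zero, except the last column (the uncertainty column), whose entries $\epsilon_1,\ldots,\epsilon_k$ are all non-null, with $0<\epsilon_1,\ldots,\epsilon_k<1$; (ii) the columns corresponding to the elements $\theta_{i_1},\ldots,\theta_{i_s}$ are null (all their entries are zero). Then Dempster's rule of combination applied to $m_1,\ldots,m_k$ gives $$m(\theta_{i_1}\cup\cdots\cup\theta_{i_s})=1.$$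
   Context: Shafer's model is used: $\theta_1,\ldots,\theta_n$ are exclusive and exhaustive, and $2^\Theta$ is the set of all subsets of $\Theta$, with $\theta_i$ identified with $\{\theta_i\}$ and unions of $\theta_i$'s with the corresponding subsets. An uncertainty is a union of several distinct $\theta_i$'s. A basic belief assignment on $2^\Theta$ is a map $m:2^\Theta\to[0,1]$ with $m(\emptyset)=0$ and $\sum_{A\in 2^\Theta}m(A)=1$. The mass matrix has as its entry in row $i$ and in the column associated with a set $X$ the value $m_i(X)$. Dempster's rule for $k$ sources: $m(\emptyset)=0$ and, for $B\in 2^\Theta$, $B\ne\emptyset$, $$m(B)=\frac{\sum_{X_1\cap\cdots\cap X_k=B}\prod_{i=1}^k m_i(X_i)}{1-\sum_{X_1\cap\cdots\cap X_k=\emptyset}\prod_{i=1}^k m_i(X_i)},$$ where the sums are over $X_1,\ldots,X_k\in 2^\Theta$. *)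

(* Defs.v *)
From HB Require Import structures.
From mathcomp Require Import all_boot all_order all_algebra.
Set Implicit Arguments.
Unset Strict Implicit.
Unset Printing Implicit Defensive.
Import Order.TTheory GRing.Theory Num.Theory.
Local Open Scope ring_scope.

(* The frame Theta = {theta_1, ..., theta_n} is 'I_n: under Shafer's model      *)
(* theta_j is the singleton [set j] and 2^Theta is {set 'I_n}.                  *)

Definition is_bba (R : realFieldType) (n : nat) (m : {set 'I_n} -> R) : Prop :=
  [/\ forall A, 0 <= m A <= 1, m set0 = 0 & \sum_(A : {set 'I_n}) m A = 1].

(* A union of several (at least two) distinct theta_j's. *)
Definition is_uncertainty (n : nat) (U : {set 'I_n}) : Prop := (1 < #|U|)%N.

(* The n + 1 columns: lshift 1 j is the column of theta_j, and the last column  *)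
(* rshift n ord0 is the column of the uncertainty U.                            *)
Definition column_set (n : nat) (U : {set 'I_n}) (c : 'I_(n + 1)) : {set 'I_n} :=
  match split c with
  | inl j => [set j]
  | inr _ => U
  end.

Definition mass_matrix (R : realFieldType) (n k : nat) (U : {set 'I_n})
    (m : 'I_k -> {set 'I_n} -> R) : 'M[R]_(k, n + 1) :=
  \matrix_(i < k, c < n + 1) m i (column_set U c).

(* The sum, over all X_1, ..., X_k in 2^Theta with intersection B, of the       *)
(* products m_1(X_1) ... m_k(X_k).                                              *)
Definition conjunctive (R : realFieldType) (n k : nat)
    (m : 'I_k -> {set 'I_n} -> R) (B : {set 'I_n}) : R :=
  \sum_(X : {ffun 'I_k -> {set 'I_n}} | \bigcap_(i < k) X i == B)
     \prod_(i < k) m i (X i).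

(* If the conflict conjunctive m set0 is 1, the rule is undefined on paper; the *)
(* convention x / 0 = 0 makes every value 0 here.                               *)
Definition dempster (R : realFieldType) (n k : nat)
    (m : 'I_k -> {set 'I_n} -> R) (B : {set 'I_n}) : R :=
  if B == set0 then 0 else conjunctive m B / (1 - conjunctive m set0).

(* Main.v *)
Require Import Defs.
From mathcomp Require Import all_boot all_order all_algebra.
Import Order.TTheory GRing.Theory Num.Theory.
Local Open Scope ring_scope.

(** Only selections [X_1, ..., X_k] of focal sets contribute, and every focal
    set is [U] or a singleton outside [U].  If all the [X_i] are [U], their
    intersection is [U]; if some [X_i] is a singleton, the zero in its column
    gives a source whose focal sets are all disjoint from it, so the
    intersection is empty.  Hence the total conjunctive mass, which is [1], is
    the mass of [U] plus the conflict, and Dempster's rule divides the mass of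
    [U], positive because every epsilon is, by itself. *)

(** Expanding the product of the total masses, each equal to 1, gives one term per selection; these
    terms are then grouped by the intersection of the selection. *)
Lemma conjunctive_sum (R : realFieldType) (n k : nat)
    (m : 'I_k -> {set 'I_n} -> R) :
  (forall i, is_bba (m i)) -> \sum_(B : {set 'I_n}) conjunctive m B = 1.
Proof.
move=> hm; transitivity (\prod_(i < k) \sum_(A : {set 'I_n}) m i A).
  rewrite bigA_distr_bigA /=.
  by rewrite [RHS](partition_big (fun X : {ffun _} => \bigcap_(i < k) X i) predT).
by apply: big1 => i _; case: (hm i).
Qed.

Lemma prod_le_conjunctive (R : realFieldType) (n k : nat)
    (m : 'I_k -> {set 'I_n} -> R) (X : {ffun 'I_k -> {set 'I_n}}) :
  (forall i A, 0 <= m i A) ->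
  \prod_(i < k) m i (X i) <= conjunctive m (\bigcap_(i < k) X i).
Proof.
move=> m_ge0; rewrite /conjunctive (bigD1 X) //= lerDl.
by apply: sumr_ge0 => Y _; apply: prodr_ge0.
Qed.

Lemma dempster_eq1 (R : realFieldType) (n k : nat)
    (m : 'I_k -> {set 'I_n} -> R) (U : {set 'I_n}) :
  (forall i, is_bba (m i)) -> U != set0 -> conjunctive m U != 0 ->
  (forall B, B != U -> B != set0 -> conjunctive m B = 0) ->
  dempster m U = 1.
Proof.
move=> hm U0 cU0 c0; have := conjunctive_sum _ _ _ _ hm.
rewrite (bigD1 U) //= (bigD1 set0) 1?eq_sym //= big1; last first.
  by move=> B /andP[]; apply: c0.
(* Only the 1 in the denominator is expanded, which turns it into [conjunctive m U]. *)
by rewrite addr0 /dempster (negPf U0) => {1}<-; rewrite addrK divff.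
Qed.

(** For [k = 0] the empty intersection would be the full set. *)
Lemma bigcap_const_ord (n k : nat) (U : {set 'I_n}) :
  (0 < k)%N -> \bigcap_(i < k) U = U.
Proof.
case: k => // k _; apply/setP=> x; apply/bigcapP/idP => [/(_ ord0 isT) //|].
by move=> xU i _.
Qed.

Lemma bigcap_focal (n k : nat) (U : {set 'I_n})
    (focal : 'I_k -> {set 'I_n} -> Prop) (X : 'I_k -> {set 'I_n}) :
  (0 < k)%N ->
  (forall i A, focal i A -> A = U \/ exists2 j, j \notin U & A = [set j]) ->
  (forall j, exists i, ~ focal i [set j]) ->
  (forall i, focal i (X i)) ->
  \bigcap_(i < k) X i = U \/ \bigcap_(i < k) X i = set0.
Proof.
move=> k0 focalP unfocal Xf.
have [/forallP XU|] := boolP [forall i, X i == U].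
  by left; rewrite (eq_bigr (fun=> U)) ?bigcap_const_ord // => i _; apply/eqP.
rewrite negb_forall => /existsP[i XiU]; right.
have [/eqP|[j jU Xij]] := focalP i _ (Xf i); first by rewrite (negPf XiU).
apply/setP=> x; rewrite in_set0; apply/negP => /bigcapP xX.
have /set1P xj : x \in [set j] by rewrite -Xij xX.
(* Source [i'] would have to select a focal set containing [j]: [U] misses [j], and a singleton
   could only be [[set j]], not focal for [i']. *)
have [i' ni'] := unfocal j; have := xX i' isT; rewrite {}xj.
have [->|[j' _ Xij']] := focalP i' _ (Xf i'); first exact/negP.
by rewrite Xij' => /set1P jj'; apply: ni'; rewrite jj' -Xij'.
Qed.

Theorem mainTheorem4 (R : realFieldType) (n k : nat)
    (m : 'I_k -> {set 'I_n} -> R) (U : {set 'I_n}) (M : 'M[R]_(k, n + 1))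
    (hn : (2 <= n)%N) (hk : (2 <= k)%N)
    (hm : forall i : 'I_k, is_bba (m i))
    (hU : is_uncertainty U) (hUT : U <> [set: 'I_n])
    (hM : M = mass_matrix U m)
    (hother : forall (i : 'I_k) (X : {set 'I_n}),
       (forall c : 'I_(n + 1), X <> column_set U c) -> m i X = 0)
    (hzero : forall c : 'I_(n + 1), c <> rshift n ord0 ->
       exists i : 'I_k, M i c = 0)
    (heps : forall i : 'I_k, 0 < M i (rshift n ord0) < 1)
    (hnull : forall j : 'I_n, j \in U -> col (lshift 1 j) M = 0) :
  dempster m U = 1.
Proof.
have k0 : (0 < k)%N by apply: ltnW.
have csl j : column_set U (lshift 1 j) = [set j].
  by rewrite /column_set (unsplitK (inl j)).
have csr : column_set U (rshift n ord0) = U.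
  by rewrite /column_set (unsplitK (inr ord0)).
have m_ge0 i A : 0 <= m i A by case: (hm i) => /(_ A) /andP[].
have mU i : 0 < m i U by have := heps i; rewrite hM mxE csr => /andP[].
have focalP i A : m i A <> 0 -> A = U \/ exists2 j, j \notin U & A = [set j].
  move=> mA; have [/existsP[c /eqP]|] := boolP [exists c, A == column_set U c].
    rewrite /column_set; case: split => [j Aj|_]; last by left.
    (* A singleton inside [U] has a null column, so it is not focal. *)
    right; exists j => //; apply/negP => /hnull /matrixP /(_ i ord0).
    by rewrite hM !mxE csl -Aj.
  rewrite negb_exists => /forallP nA; case: mA; apply: hother => c.
  exact/eqP/nA.
have unfocal j : exists i, ~ (m i [set j] <> 0).
  have [|i] := hzero (lshift 1 j); first by apply/eqP; rewrite eq_lrshift.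
  by rewrite hM mxE csl => mij; exists i => /(_ mij).
apply: dempster_eq1 => //.
- by rewrite -card_gt0 ltnW.
(* The constant selection [U] alone already contributes the positive product of the epsilons. *)
- rewrite gt_eqF //; apply: (@lt_le_trans _ _ (\prod_(i < k) m i U)).
    exact: prodr_gt0.
  have := @prod_le_conjunctive _ _ _ m [ffun=> U] m_ge0.
  rewrite (eq_bigr (fun i => m i U)) => [|i _]; last by rewrite ffunE.
  rewrite (eq_bigr (fun=> U)) => [|i _]; last by rewrite ffunE.
  by rewrite bigcap_const_ord.
(* A nonzero product would make every [X i] focal, forcing [B] to be [U] or empty. *)
- move=> B BU B0; apply: big1 => X /eqP XB; apply/eqP.
  apply: contraT => /prodf_neq0 mX.
  have [] := bigcap_focal _ _ _ (fun i A => m i A <> 0) X k0 focalP unfocal.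
  + by move=> i; apply/eqP/mX.
  + by move/eqP; rewrite XB (negPf BU).
  + by move/eqP; rewrite XB (negPf B0).
Qed.
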